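(* Let $(V,V^+,e)$ be an AOU space. Then, for every $n\in\mathbb{N}$, ${}^dQ_n^{\min} = C_n^{\min}(V)$ and $(C_n^{\max}(V))^d = Q_n^{\max}$.
   Context: An AOU space $(V,V^+,e)$: $V$ is a complex vector space with a conjugate-linear involution $*$, $V_h=\{v:v^*=v\}$, $V^+\subseteq V_h$ is a cone (closed under sums and nonnegative real multiples) with $V^+\cap-V^+=\{0\}$, and $e\in V_h$ is an Archimedean order unit: for each $v\in V_h$ there is $r>0$ with $re-v\in V^+$, and if $v\in V$, $re+v\in V^+$ for all $r>0$ then $v\in V^+$. Put $e_n=\operatorname{diag}(e,\dots,e)\in M_n(V)$ and identify $M_n(V)=M_n\otimes V$. $V'$ is the space of linear functionals on $V$ continuous for any norm on $V$ extending the order norm $\|v\|=\inf\{t: -te\le v\le te\}$ on $V_h$ and for which $*$ is continuous (all norms extending the order norm that are considered are equivalent, e.g. $\|v\|_m=\sup\{|s(v)|: s \text{ a state}\}$ may be used). A matrix $(f_{i,j})\in M_n(V')$ is identified with the linear functional $f:M_n(V)\to\mathbb{C}$, $f((v_{i,j}))=\sum_{i,j}f_{i,j}(v_{i,j})$. $C_n^{\min}(V)=\{(v_{i,j})\in M_n(V):\sum_{i,j}\overline{\lambda_i}\lambda_jv_{i,j}\in V^+\ \forall\lambda_1,\dots,\lambda_n\in\mathbb{C}\}$. $D_n^{\max}(V)=\{\sum_{i=1}^ka_i\otimes v_i:a_i\in M_n^+,v_i\in V^+,k\in\mathbb{N}\}$ and $C_n^{\max}(V)=\{A\in M_n(V):re_n+A\in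 D_n^{\max}(V)\ \forall r>0\}$. For a cone $P_n\subseteq M_n(V)$ of an operator system structure on $V$, $P_n^d=\{f:M_n(V)\to\mathbb{C}: f\text{ linear},\ f(P_n)\subseteq[0,\infty)\}$; such $f$ correspond to elements $(f_{i,j})$ of $M_n(V')$ via $f_{i,j}(v)=f(v\otimes E_{i,j})$. In particular $(V^+)^d$ is the set of positive linear functionals on $V$. For $Q_n\subseteq M_n(V')$, ${}^dQ_n=\{v\in M_n(V): f(v)\ge0\ \forall f\in Q_n\}$. $Q_n^{\min}=\{X^*GX: X\in M_{m,n}(\mathbb{C}),\ G=\operatorname{diag}(g_1,\dots,g_m),\ g_i\in(V^+)^d,\ m\in\mathbb{N}\}\subseteq M_n(V')$, and $Q_n^{\max}=\{(f_{i,j})\in M_n(V'):(f_{i,j}(v))\in M_n^+\ \forall v\in V^+\}$. *)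

(* Defs.v *)
From HB Require Import structures.
From mathcomp Require Import all_boot all_order all_algebra.
From mathcomp Require Import complex.
From mathcomp Require Import boolp classical_sets functions reals.

Set Implicit Arguments.
Unset Strict Implicit.
Unset Printing Implicit Defensive.

Import Order.TTheory GRing.Theory Num.Theory.

Local Open Scope classical_set_scope.
Local Open Scope ring_scope.
Local Open Scope sesquilinear_scope.

Section ModuleMatrices.
Variables (R : realType) (W : lmodType R[i]).

(* The library has no module structure on 'M[W]_(m, n) over the scalars of W,
   and no product of a scalar matrix with a matrix over W; X ^t* is the
   conjugate transpose of X. *)
Definition mxscale m n (c : R[i]) (A : 'M[W]_(m, n)) : 'M[W]_(m, n) :=
  map_mx (fun w => c *: w) A.

Definition lmulmx m n p (X : 'M[R[i]]_(m, n)) (A : 'M[W]_(n, p)) :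
    'M[W]_(m, p) :=
  \matrix_(i, j) \sum_k X i k *: A k j.

Definition rmulmx m n p (A : 'M[W]_(m, n)) (X : 'M[R[i]]_(n, p)) :
    'M[W]_(m, p) :=
  \matrix_(i, j) \sum_k X k j *: A i k.

Definition congr_mx m n (X : 'M[R[i]]_(m, n)) (G : 'M[W]_m) : 'M[W]_n :=
  rmulmx (lmulmx (X ^t*) G) X.

Definition mxtensor m n (a : 'M[R[i]]_(m, n)) (w : W) : 'M[W]_(m, n) :=
  map_mx (fun c => c *: w) a.

Definition mx_linear n (f : 'M[W]_n -> R[i]) : Prop :=
  forall (c : R[i]) (A B : 'M[W]_n), f (mxscale c A + B) = c * f A + f B.

End ModuleMatrices.

(* In the order of R[i], 0 <= z means that z is real and nonnegative; so psd
   matrices are automatically Hermitian. *)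
Definition psd (R : realType) n (a : 'M[R[i]]_n) : Prop :=
  forall x : 'cV[R[i]]_n, 0 <= (x ^t* *m a *m x) 0 0.

Record is_AOU (R : realType) (V : lmodType R[i])
    (star : V -> V) (Vpos : set V) (e : V) : Prop := IsAOU {
  star_add : forall v w, star (v + w) = star v + star w ;
  star_scale : forall (c : R[i]) v, star (c *: v) = c^* *: star v ;
  star_invol : forall v, star (star v) = v ;
  pos_herm : forall v, Vpos v -> star v = v ;
  pos_add : forall v w, Vpos v -> Vpos w -> Vpos (v + w) ;
  pos_scale : forall (r : R) v, 0 <= r -> Vpos v -> Vpos (r%:C%C *: v) ;
  pos_proper : Vpos `&` [set v | Vpos (- v)] = [set 0] ;
  unit_herm : star e = e ;
  unit_order : forall v, star v = v ->
    exists2 r : R, 0 < r & Vpos (r%:C%C *: e - v) ;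
  unit_arch : forall v,
    (forall r : R, 0 < r -> Vpos (r%:C%C *: e + v)) -> Vpos v
}.

Section Duals.
Variables (R : realType) (V : lmodType R[i]).
Variables (star : V -> V) (Vpos : set V) (e : V).

Definition order_norm (v : V) : R :=
  inf [set t : R | Vpos (v + t%:C%C *: e) /\ Vpos (t%:C%C *: e - v)].

Record is_norm (N : V -> R) : Prop := IsNorm {
  norm_triangle : forall v w, N (v + w) <= N v + N w ;
  norm_scale : forall (c : R[i]) v, N (c *: v) = ComplexField.Normc.normc c * N v ;
  norm_definite : forall v, N v = 0 -> v = 0
}.

Definition norm_continuous (U W : zmodType) (N : U -> R) (M : W -> R)
    (f : U -> W) : Prop :=
  forall u (eps : R), 0 < eps -> exists2 delta : R, 0 < delta &
    forall u', N (u' - u) < delta -> M (f u' - f u) < eps.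

Definition admissible_norm (N : V -> R) : Prop :=
  [/\ is_norm N,
      forall v, star v = v -> N v = order_norm v &
      norm_continuous N N star].

(* V'.  All admissible norms are equivalent, so it does not matter whether
   continuity is asked for one of them or for all of them.  On the scalars,
   normc is the modulus with values in R. *)
Definition cdual : set (V -> R[i]) :=
  [set f | scalar f /\
     forall N, admissible_norm N ->
       norm_continuous N (@ComplexField.Normc.normc R) f].

(* (V^+)^d *)
Definition pos_functional : set (V -> R[i]) :=
  [set g | scalar g /\ forall v, Vpos v -> 0 <= g v].

Definition mx_pairing n (F : 'M[V -> R[i]]_n) (A : 'M[V]_n) : R[i] :=
  \sum_i \sum_j F i j (A i j).

Definition mx_entries n (f : 'M[V]_n -> R[i]) : 'M[V -> R[i]]_n :=
  \matrix_(i, j) (fun v => f (mxtensor (delta_mx i j) v)).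

(* P^d as a set of linear functionals on M_n(V). *)
Definition mx_dual n (P : set 'M[V]_n) : set ('M[V]_n -> R[i]) :=
  [set f | mx_linear f /\ forall A, P A -> 0 <= f A].

(* ^dQ *)
Definition mx_predual n (Q : set 'M[V -> R[i]]_n) : set 'M[V]_n :=
  [set A | forall F, Q F -> 0 <= mx_pairing F A].

Definition Cmin n : set 'M[V]_n :=
  [set A | forall lam : 'I_n -> R[i],
     Vpos (\sum_i \sum_j ((lam i)^* * lam j) *: A i j)].

Definition Dmax n : set 'M[V]_n :=
  [set A | exists k (a : 'I_k -> 'M[R[i]]_n) (v : 'I_k -> V),
     [/\ forall l, psd (a l), forall l, Vpos (v l) &
         A = \sum_l mxtensor (a l) (v l)]].

Definition Cmax n : set 'M[V]_n :=
  [set A | forall r : R, 0 < r -> @Dmax n (mxscale r%:C%C e%:M + A)].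

(* Functionals V -> R[i]^o carry the pointwise module structure. *)
Definition Qmin n : set 'M[V -> R[i]]_n :=
  [set F | exists m (X : 'M[R[i]]_(m, n)) (g : 'I_m -> V -> R[i]^o),
     (forall k, pos_functional (g k)) /\
     F = congr_mx X (diag_mx (\row_k g k))].

Definition Qmax n : set 'M[V -> R[i]]_n :=
  [set F : 'M[V -> R[i]]_n | (forall i j, cdual (F i j)) /\
     forall v, Vpos v -> psd (map_mx (fun f : V -> R[i] => f v) F)].

(* mx_pairing and mx_entries are mutually inverse identifications of linear
   functionals on M_n(V) with matrices of linear functionals on V. *)
Lemma mx_entriesK n (f : 'M[V]_n -> R[i]) :
  mx_linear f -> mx_pairing (mx_entries f) = f.
Proof.
move=> fl; apply/funext => A; rewrite /mx_pairing.
have f0 : f 0 = 0.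
  have := fl 1 0 0; rewrite mul1r.
  have -> : mxscale 1 0 + 0 = 0 :> 'M[V]_n.
    by apply/matrixP => i j; rewrite !mxE scaler0 addr0.
  by move/eqP; rewrite -[X in X == _]addr0 (inj_eq (addrI _)) => /eqP.
have fD B B' : f (B + B') = f B + f B'.
  have := fl 1 B B'; rewrite mul1r => <-; congr (f (_ + _)).
  by apply/matrixP => i j; rewrite !mxE scale1r.
have fS I (r : seq I) (B : I -> 'M[V]_n) :
    f (\sum_(i <- r) B i) = \sum_(i <- r) f (B i).
  by apply: (big_morph f fD f0).
have -> : A = \sum_i \sum_j mxtensor (delta_mx i j) (A i j).
  apply/matrixP => i j; rewrite summxE (bigD1 i) //= summxE (bigD1 j) //=.
  rewrite !mxE !eqxx scale1r !big1 ?addr0// => [k ki|k kj].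
    by rewrite summxE big1// => l _; rewrite !mxE eq_sym (negbTE ki) scale0r.
  by rewrite !mxE eqxx eq_sym (negbTE kj) scale0r.
rewrite fS; apply: eq_bigr => i _; rewrite fS; apply: eq_bigr => j _.
rewrite mxE; congr (f (mxtensor _ _)).
rewrite summxE (bigD1 i) //= summxE (bigD1 j) //=.
rewrite !mxE !eqxx scale1r !big1 ?addr0// => [k ki|k kj].
  by rewrite summxE big1// => l _; rewrite !mxE eq_sym (negbTE ki) scale0r.
by rewrite !mxE eqxx eq_sym (negbTE kj) scale0r.
Qed.

Lemma mx_pairingK n (F : 'M[V -> R[i]]_n) :
  (forall i j, scalar (F i j)) -> mx_entries (mx_pairing F) = F.
Proof.
move=> Fl; apply/matrixP => i j; rewrite mxE; apply/funext => v.
have F0 k l : F k l 0 = 0.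
  have := Fl k l 1 0 0; rewrite scaler0 addr0 mul1r.
  by move/eqP; rewrite -[X in X == _]addr0 (inj_eq (addrI _)) => /eqP.
rewrite /mx_pairing (bigD1 i) //= (bigD1 j) //= !mxE !eqxx scale1r.
rewrite !big1 ?addr0// => [k ki|k kj].
  by rewrite big1// => l _; rewrite !mxE (negbTE ki) scale0r F0.
by rewrite !mxE eqxx (negbTE kj) scale0r F0.
Qed.

End Duals.

Arguments mx_entries {R V} n f.
Arguments mx_dual {R V n} P.
Arguments mx_predual {R V n} Q.
Arguments Cmin {R V} Vpos n.
Arguments Dmax {R V} Vpos n.
Arguments Cmax {R V} Vpos e n.
Arguments Qmin {R V} Vpos n.
Arguments Qmax {R V} star Vpos e n.

(* Main.v *)
Require Import Defs.
From HB Require Import structures.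
From mathcomp Require Import all_boot all_order all_algebra.
From mathcomp Require Import ring lra.
From mathcomp Require Import complex.
From mathcomp Require Import boolp classical_sets functions reals.

(* Both equalities reduce to one-variable facts through the pairing
   f (a (x) v) = sum_ij a_ij f_ij(v).  For the first, X^*GX pairs with A as
   sum_k g_k (sum_ij conj(X_ki) X_kj A_ij), so it is enough that an element on
   which all positive functionals are nonnegative lies in V^+; this separation
   property is obtained from Zorn's lemma by enlarging V^+ to a cone K with
   K \/ -K everything, along which e defines a real coordinate.  For the
   second, positivity of f on the tensors (conj x_i x_j)_ij (x) v is positive
   semidefiniteness of (f_ij(v)); conversely the spectral decomposition of a
   gives sum_ij a_ij b_ij >= 0 for positive semidefinite a and b.  Continuity of
   the f_ij follows by polarization, as positive functionals are continuous. *)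

Set Implicit Arguments.
Unset Strict Implicit.
Unset Printing Implicit Defensive.

Import Order.TTheory GRing.Theory Num.Theory.

Local Open Scope classical_set_scope.
Local Open Scope ring_scope.
Local Open Scope sesquilinear_scope.

(** * Separation of a point from a cone with order unit, over the reals *)

Definition convex_cone (R : realType) (W : lmodType R) (K : set W) : Prop :=
  [/\ K 0, forall u v, K u -> K v -> K (u + v) &
      forall (r : R) u, 0 <= r -> K u -> K (r *: u)].

Section ConeSeparation.
Variables (R : realType) (W : lmodType R) (K0 : set W) (e x0 : W).
Hypothesis coneK0 : convex_cone K0.

(** A cone maximal among those containing [K0] and avoiding [x0] is total: if [x] and [- x] were
    both missing, adjoining either would capture [x0], and the two expressions for [x0] combine to
    put it in the cone. *)
Lemma total_cone_extension : ~ K0 x0 -> exists K : set W,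
  [/\ convex_cone K, K0 `<=` K, ~ K x0 & forall x, K x \/ K (- x)].
Proof.
move=> K0x0.
pose good (K : set W) := [/\ convex_cone K, K0 `<=` K & ~ K x0].
(* The empty chain has empty union, which is not a cone; the guard [K !=set0] admits it, and
   [K_neq0] excludes it for the maximal element. *)
have chainP F : F `<=` [set K | K !=set0 -> good K] -> total_on F subset ->
    (\bigcup_(X in F) X) !=set0 -> good (\bigcup_(X in F) X).
  move=> Fgood totF [x [X FX Xx]].
  have [_ K0X _] := Fgood X FX (ex_intro _ x Xx).
  split; last 1 first.
  - by move=> [Y FY Yx0]; have [] := Fgood Y FY (ex_intro _ x0 Yx0).
  - split.
    + by exists X => //; apply: K0X; case: coneK0.
    + move=> u v [Y FY Yu] [Z FZ Zv].
      have [[_ addY _] _ _] := Fgood Y FY (ex_intro _ u Yu).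
      have [[_ addZ _] _ _] := Fgood Z FZ (ex_intro _ v Zv).
      have [YZ|ZY] := totF Y Z FY FZ.
        by exists Z => //; apply: addZ => //; exact: YZ.
      by exists Y => //; apply: addY => //; exact: ZY.
    + move=> r u r0 [Y FY Yu]; exists Y => //.
      by have [[_ _ scaleY] _ _] := Fgood Y FY (ex_intro _ u Yu); exact: scaleY.
  - by move=> y K0y; exists X => //; exact: K0X.
have [K [goodK maxK]] := Zorn_bigcup chainP.
have K_neq0 : K !=set0.
  apply: contrapT => K0'; apply: (maxK K0) => [|_]; last by split.
  split; first by move=> y Ky; case: K0'; exists y.
  by move=> K0K; apply: K0'; exists 0; apply: K0K; case: coneK0.
have [coneK K0K Kx0] := goodK K_neq0.
have [K_0 Kadd Kscale] := coneK.
(* [L] strictly contains [K], so by maximality it cannot avoid [x0]; a zero coefficient [r] would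
   put [x0] in [K]. *)
have adjoin x : ~ K x -> exists k r, [/\ K k, 0 < r & x0 = k + r *: x].
  move=> nKx; apply: contrapT => nx0.
  pose L := [set y | exists k r, [/\ K k, 0 <= r & y = k + r *: x]].
  have KL : K `<=` L by move=> k Kk; exists k, 0; rewrite scale0r addr0.
  apply: (maxK L).
    split=> // LK; apply/nKx/LK; exists 0, 1.
    by rewrite scale1r add0r; split.
  move=> _; split.
  - split; first exact: KL.
    + move=> _ _ [k [r [Kk r0 ->]]] [l [s [Kl s0 ->]]].
      exists (k + l), (r + s); split; [exact: Kadd|exact: addr_ge0|].
      by rewrite scalerDl addrACA.
    + move=> s _ s0 [k [r [Kk r0 ->]]].
      exists (s *: k), (s * r); split; [exact: Kscale|exact: mulr_ge0|].
      by rewrite scalerDr scalerA.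
  - by move=> y /K0K /KL.
  - move=> [k [r [Kk r0 x0E]]]; apply: nx0; exists k, r; split => //.
    rewrite lt_neqAle r0 andbT; apply/eqP => rE.
    by apply: Kx0; rewrite x0E -rE scale0r addr0.
exists K; split=> // x; apply: contrapT => /not_orP[/adjoin + /adjoin].
move=> [k [r [Kk r0 x0k]]] [l [s [Kl s0 x0l]]]; apply: Kx0.
have sr0 : 0 < s + r by exact: addr_gt0.
(* Weighting [x0 = k + r *: x] by [s] and [x0 = l - s *: x] by [r] cancels [x]. *)
have -> : x0 = (s + r)^-1 *: (s *: k + r *: l).
  have -> : s *: k + r *: l = (s + r) *: x0.
    rewrite scalerDl {1}x0k x0l !scalerDr !scalerN !scalerA mulrC.
    by rewrite [RHS]addrACA subrr addr0.
  by rewrite scalerA mulVf ?scale1r// gt_eqF.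
apply: (Kscale); first by rewrite invr_ge0 ltW.
by apply: (Kadd); apply: (Kscale) => //; exact: ltW.
Qed.

Hypothesis unit_e : forall x, exists2 r : R, 0 < r & K0 (r *: e - x).

(** The bound at [x0] is weak because [f] vanishes on elements infinitesimal with respect to [e],
    and [x0] may be one. *)
Lemma cone_separation : ~ K0 x0 -> exists f : W -> R,
  [/\ scalar f, forall x, K0 x -> 0 <= f x, f e = 1 & f x0 <= 0].
Proof.
move=> /total_cone_extension[K [[K_0 Kadd Kscale] K0K Kx0 Ktot]].
have [r0 r0_gt0 K0r0] := unit_e 0.
have Ke : K e.
  have -> : e = r0^-1 *: (r0 *: e - 0).
    by rewrite subr0 scalerA mulVf ?scale1r// gt_eqF.
  by apply: (Kscale); [rewrite invr_ge0 ltW|exact: K0K].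
have KNe : ~ K (- e).
  move=> KNe; apply: Kx0; have [r r_gt0 /K0K] := unit_e (- x0).
  rewrite opprK => /Kadd/(_ (Kscale r _ (ltW r_gt0) KNe)).
  by rewrite scalerN addrAC subrr add0r.
have Kge0 t : K (t *: e) -> 0 <= t.
  move=> Kte; rewrite leNgt; apply/negP => t_lt0; apply: KNe.
  have -> : - e = (- t)^-1 *: (t *: e).
    by rewrite scalerA invrN mulNr mulVf ?lt_eqF// scaleN1r.
  by apply: (Kscale) => //; rewrite invr_ge0 oppr_ge0 ltW.
(* Infinitesimals form a complement of the line spanned by e; f is the
   resulting coordinate along e. *)
pose I := [set y | forall eps : R, 0 < eps -> K (eps *: e - y) /\ K (eps *: e + y)].
have IN y : I y -> I (- y).
  by move=> Iy eps /Iy[]; rewrite opprK.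
have ID y z : I y -> I z -> I (y + z).
  move=> Iy Iz eps eps0; have eps20 : 0 < eps / 2 by rewrite divr_gt0.
  have [y1 y2] := Iy _ eps20; have [z1 z2] := Iz _ eps20.
  have epsE : eps *: e = (eps / 2) *: e + (eps / 2) *: e.
    by rewrite -scalerDl -splitr.
  split; rewrite epsE ?opprD addrACA; exact: Kadd.
have IZp (r : R) y : 0 < r -> I y -> I (r *: y).
  move=> r_gt0 Iy eps eps0.
  have [y1 y2] := Iy (r^-1 * eps) (mulr_gt0 (etrans (invr_gt0 _) r_gt0) eps0).
  have epsE : eps *: e = r *: ((r^-1 * eps) *: e).
    by rewrite scalerA mulrA mulfV ?mul1r// gt_eqF.
  by rewrite epsE -scalerBr -scalerDr; split; apply: (Kscale) => //; exact: ltW.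
have I0 : I 0.
  by move=> eps eps0; rewrite subr0 addr0; split; apply: (Kscale) => //; exact: ltW.
have IZ (r : R) y : I y -> I (r *: y).
  move=> Iy; have [r_gt0|r_lt0|<-] := ltgtP 0 r.
  - exact: IZp.
  - by rewrite -[r]opprK scaleNr -scalerN; apply: IZp; [rewrite oppr_gt0|exact: IN].
  - by rewrite scale0r.
have Ie t : I (t *: e) -> t = 0.
  move=> It; apply/eqP; rewrite eq_le; apply/andP; split; apply/ler_addgt0Pr => eps eps0.
    have [+ _] := It _ eps0; rewrite -scalerBl => /Kge0.
    by rewrite subr_ge0 add0r.
  have [_ +] := It _ eps0; rewrite -scalerDl => /Kge0.
  by rewrite addrC.
have /choice[f If] x : exists c : R, I (x - c *: e).
  pose S := [set t : R | K (x - t *: e)].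
  have Sup t : K (t *: e - x) -> ubound S t.
    move=> Kt s Ks; have := Kadd _ _ Kt Ks.
    by rewrite addrA subrK -scalerBl => /Kge0; rewrite subr_ge0.
  have S_sup : has_sup S.
    split.
      have [r _ /K0K] := unit_e (- x); exists (- r).
      by rewrite /S /= scaleNr opprK addrC -[x in _ + x]opprK.
    by have [r _ /K0K] := unit_e x; exists r; exact: Sup.
  (* Above the supremum membership in [S] fails, so totality of [K] gives the first half; elements
     of [S] close to the supremum give the second. *)
  exists (sup S) => eps eps0; split.
    have [|] := Ktot (x - (sup S + eps) *: e).
      move=> /(ub_le_sup S_sup.2); rewrite gerDl => eps_le0.
      by move: eps0; rewrite ltNge eps_le0.
    by rewrite !opprB scalerDl addrA [eps *: e + _]addrC.
  have [t St supt] := sup_adherent eps0 S_sup.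
  have -> : eps *: e + (x - sup S *: e) =
            (x - t *: e) + (t - (sup S - eps)) *: e.
    by rewrite !scalerBl opprB addrCA [RHS]addrA subrK.
  by apply: (Kadd) => //; apply: (Kscale) => //; rewrite subr_ge0 ltW.
(* [I] meets the line through [e] only in 0, so the coordinate is unique; linearity and the value at
   [e] follow from this. *)
have f_uniq x c : I (x - c *: e) -> f x = c.
  move=> Ic; apply/eqP; rewrite -subr_eq0; apply/eqP/Ie.
  have := ID _ _ Ic (IN _ (If x)).
  by rewrite opprB addrC addrA subrK -scalerBl.
have fK x : K x -> 0 <= f x.
  move=> Kx; apply/ler_addgt0Pr => eps eps0; rewrite addrC; apply: Kge0.
  have [+ _] := If x _ eps0 => /Kadd/(_ Kx).
  by rewrite opprB addrA subrK -scalerDl.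
have f_lin : scalar f.
  move=> a u v; apply: f_uniq.
  have := ID _ _ (IZ a _ (If u)) (If v).
  by rewrite scalerBr scalerA addrACA -opprD -scalerDl.
exists f; split => //.
- by move=> x /K0K /fK.
- by apply: f_uniq; rewrite scale1r subrr.
- have := fK (- x0); have [//|KNx0 /(_ KNx0)] := Ktot x0.
  suff -> : f (- x0) = - f x0 by rewrite oppr_ge0.
  by apply: f_uniq; rewrite scaleNr -opprD; exact: IN.
Qed.

End ConeSeparation.

(** * Restriction of scalars, making real cone separation applicable to [V] *)

Definition real_restriction (R : realType) (V : lmodType R[i]) : Type := V.

Section RealRestriction.
Variables (R : realType) (V : lmodType R[i]).

HB.instance Definition _ := GRing.Zmodule.on (real_restriction V).

Let rscale (r : R) (v : real_restriction V) : real_restriction V :=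
  (r%:C%C *: (v : V)).

Let rscaleA a b v : rscale a (rscale b v) = rscale (a * b) v.
Proof. by rewrite /rscale scalerA rmorphM. Qed.

Let rscale1 : left_id 1 rscale.
Proof. by move=> v; rewrite /rscale rmorph1 scale1r. Qed.

Let rscaleDr : right_distributive rscale +%R.
Proof. by move=> a u v; rewrite /rscale scalerDr. Qed.

Let rscaleDl v : {morph rscale^~ v : a b / a + b}.
Proof. by move=> a b; rewrite /rscale rmorphD scalerDl. Qed.

HB.instance Definition _ := GRing.Zmodule_isLmodule.Build R
  (real_restriction V) rscaleA rscale1 rscaleDr rscaleDl.

Lemma real_restrictionZE (r : R) (v : V) :
  r *: (v : real_restriction V) = r%:C%C *: v :> V.
Proof. by []. Qed.

End RealRestriction.

(** * Rules for complex-linear functionals *)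

Section ScalarTheory.
Variables (R : realType) (V : lmodType R[i]) (g : V -> R[i]).
Hypothesis g_lin : scalar g.

Lemma scalar_fun0 : g 0 = 0.
Proof.
have := g_lin 1 0 0; rewrite scaler0 addr0 mul1r.
by move/eqP; rewrite -[X in X == _]addr0 (inj_eq (addrI _)) => /eqP.
Qed.

Lemma scalar_funD u v : g (u + v) = g u + g v.
Proof. by have := g_lin 1 u v; rewrite scale1r mul1r. Qed.

Lemma scalar_funZ c v : g (c *: v) = c * g v.
Proof. by have := g_lin c v 0; rewrite !addr0 scalar_fun0 addr0. Qed.

Lemma scalar_funN v : g (- v) = - g v.
Proof. by rewrite -scaleN1r scalar_funZ mulN1r. Qed.

Lemma scalar_funB u v : g (u - v) = g u - g v.
Proof. by rewrite scalar_funD scalar_funN. Qed.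

Lemma scalar_fun_sum I (r : seq I) (P : pred I) (F : I -> V) :
  g (\sum_(k <- r | P k) F k) = \sum_(k <- r | P k) g (F k).
Proof. exact: (big_morph g scalar_funD scalar_fun0). Qed.

End ScalarTheory.

(** * Positive functionals determine the cone of an AOU space *)

Section AOU.
Variables (R : realType) (V : lmodType R[i]).
Variables (star : V -> V) (Vpos : set V) (e : V).
Hypothesis hV : is_AOU star Vpos e.

Lemma star0 : star 0 = 0.
Proof.
have := star_add hV 0 0; rewrite addr0.
by move/eqP; rewrite -[X in X == _]addr0 (inj_eq (addrI _)) => /eqP.
Qed.

Lemma starN v : star (- v) = - star v.
Proof. by rewrite -scaleN1r (star_scale hV) rmorphN1 scaleN1r. Qed.

Lemma star_scaleR (r : R) v : star (r%:C%C *: v) = r%:C%C *: star v.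
Proof. by rewrite (star_scale hV); congr (_ *: _); exact: conjc_real. Qed.

Lemma hermitian_part_star v : star (v + star v) = v + star v.
Proof. by rewrite (star_add hV) (star_invol hV) addrC. Qed.

Lemma skew_part_star v : star ('i%C *: (star v - v)) = 'i%C *: (star v - v).
Proof.
rewrite (star_scale hV) (star_add hV) (star_invol hV) starN.
rewrite -opprB scalerN -scaleNr; congr (_ *: _).
by apply/eqP; rewrite eq_complex /= oppr0 opprK !eqxx.
Qed.

Lemma Vpos_scale_gt0 (r : R) v : 0 < r -> Vpos (r%:C%C *: v) -> Vpos v.
Proof.
move=> r0 vp; have rV0 : 0 <= r^-1 by rewrite invr_ge0 ltW.
by have := pos_scale hV rV0 vp; rewrite scalerA -rmorphM mulVf ?scale1r// gt_eqF.
Qed.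

Lemma Vpos_unit : Vpos e.
Proof.
have [r r0] := unit_order hV star0; rewrite subr0; exact: Vpos_scale_gt0.
Qed.

Lemma Vpos0 : Vpos 0.
Proof.
by have := pos_scale hV (lexx 0) Vpos_unit; rewrite rmorph0 scale0r.
Qed.

Lemma Vpos_antisym v : Vpos v -> Vpos (- v) -> v = 0.
Proof.
by move=> vp vn; suff: [set 0] v by []; rewrite -(pos_proper hV).
Qed.

(** [v] is the difference of the positive elements [r e] and [r e - v], on which [g] is real. *)
Lemma pos_functional_hermitian g v : pos_functional Vpos g -> star v = v ->
  g v \is Num.real.
Proof.
move=> [g_lin g_pos] /(unit_order hV)[r r0 /g_pos].
rewrite (scalar_funB g_lin) (scalar_funZ g_lin).
move=> /ger0_real gr; rewrite -[g v](subKr (r%:C%C * g e)) rpredB//.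
by apply: ger0_real; apply: mulr_ge0; [rewrite ler0c ltW|exact/g_pos/Vpos_unit].
Qed.

(** The Archimedean property leaves room to separate [r e + a] in place of [a]; since [f e = 1], the
    weak bound becomes [f a <= - r < 0]. *)
Lemma pos_functional_separation a : star a = a -> ~ Vpos a ->
  exists2 g, pos_functional Vpos g & ~ 0 <= g a.
Proof.
move=> a_h a_npos.
have [r r0 ra_npos] : exists2 r : R, 0 < r & ~ Vpos (r%:C%C *: e + a).
  apply: contrapT => nex; apply/a_npos/(unit_arch hV) => r r0.
  by apply: contrapT => ?; apply: nex; exists r.
pose W : lmodType R := real_restriction V.
(* Enlarging the cone by all skew-adjoint elements makes e an order unit
   of all of V. *)
pose K : set W := [set v | Vpos ((v : V) + star v)].
have coneK : convex_cone K.
  split; rewrite /K /=.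
  - by rewrite star0 addr0; exact: Vpos0.
  - by move=> u v Ku Kv; rewrite (star_add hV) addrACA; exact: (pos_add hV).
  - move=> s u s0 Ku; rewrite real_restrictionZE star_scaleR -scalerDr.
    exact: (pos_scale hV).
have unitK (x : W) : exists2 s : R, 0 < s & K (s *: (e : W) - x).
  have [s s0 sp] := unit_order hV (hermitian_part_star x).
  exists (s / 2); first by rewrite divr_gt0.
  rewrite /K /= real_restrictionZE (star_add hV) starN star_scaleR (unit_herm hV).
  by rewrite addrACA -opprD -scalerDl -rmorphD -splitr.
have hermK v : star v = v -> K v <-> Vpos v.
  move=> v_h; rewrite /K /= v_h; have -> : v + v = (2 : R)%:C%C *: v.
    by rewrite rmorph_nat scaler_nat mulr2n.
  by split; [exact: Vpos_scale_gt0|exact: (pos_scale hV)].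
have [|f [f_lin f_pos fe fx0]] :=
    @cone_separation R W K e ((r *: (e : W)) + a) coneK unitK.
  move=> /hermK H; apply: ra_npos; apply: H.
  by rewrite (star_add hV) star_scaleR (unit_herm hV) a_h.
pose fl := GRing.isLinear.Build R W R^o *%R f f_lin.
pose f' : {scalar W} := HB.pack f fl.
have fD u v : f (u + v) = f u + f v := raddfD f' u v.
have fZ (s : R) (v : V) : f (s%:C%C *: v) = s * f v := linearZ_LR f' s v.
have f_skew v : star v = - v -> f v = 0.
  move=> vs; apply/eqP; rewrite eq_le f_pos; last first.
    by rewrite /K /= vs subrr; exact: Vpos0.
  rewrite andbT -oppr_ge0 -[- f v](raddfN f') f_pos//.
  by rewrite /K /= starN vs opprK addNr; exact: Vpos0.
(* The complexification [f v - i f (i v)] of [f]. For positive [v] the second term vanishes, because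
   [i v] is skew-adjoint. *)
exists (fun v => (f v +i* (- f ('i%C *: v)))%C).
  split=> [c u v|v vp]; last first.
    rewrite lecE /= (f_skew ('i%C *: v)) ?oppr0 ?eqxx ?f_pos//.
      by apply/hermK => //; exact: (pos_herm hV).
    rewrite (star_scale hV) (pos_herm hV vp) -scaleNr; congr (_ *: _).
    by apply/eqP; rewrite eq_complex /= oppr0 !eqxx.
  have fcu w : f (c *: w) = complex.Re c * f w + complex.Im c * f ('i%C *: w).
    have cE : c = (complex.Re c)%:C%C + (complex.Im c)%:C%C * 'i%C.
      by rewrite mulrC; exact: complexE.
    by rewrite [in LHS]cE scalerDl fD fZ -scalerA fZ.
  have i2 w : f ('i%C *: ('i%C *: w)) = - f w.
    by rewrite scalerA -expr2 sqr_i scaleN1r -(raddfN f').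
  rewrite scalerDr !fD scalerA mulrC -scalerA !fcu i2.
  case: c {fcu} => a1 b1 /=.
  apply/eqP; rewrite eq_complex /=; apply/andP; split; apply/eqP; ring.
rewrite lecE /= => /andP[_ fa0].
move: fx0; rewrite fD [f (_ *: _)](fZ r e) fe mulr1 leNgt.
by rewrite ltr_pwDl.
Qed.

(** That [v] is Hermitian has to be derived: [b], twice the imaginary part of [v], is annihilated by
    every positive functional, so [b] and [- b] are positive and [b = 0]. *)
Lemma Vpos_from_pos_functional v :
  (forall g, pos_functional Vpos g -> 0 <= g v) -> Vpos v.
Proof.
move=> gv0.
have hermP a : star a = a -> (forall g, pos_functional Vpos g -> 0 <= g a) ->
    Vpos a.
  move=> a_h ga; apply: contrapT => /(pos_functional_separation a_h)[g gp].
  by apply; exact: ga.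
pose b := 'i%C *: (star v - v).
have b_h : star b = b by exact: skew_part_star.
(* [g b] is real as [b] is Hermitian, and it is [i] times the real number [g (star v) - g v]. *)
have gb g : pos_functional Vpos g -> g b = 0.
  move=> gp; have [g_lin g_pos] := gp.
  have gvs : g (v + star v) \is Num.real.
    exact/pos_functional_hermitian/hermitian_part_star.
  have gvr := ger0_real (gv0 g gp).
  have gsr : g (star v) - g v \is Num.real.
    move: gvs; rewrite (scalar_funD g_lin) => gvs.
    rewrite rpredB//.
    by rewrite -[g (star v)](addKr (g v)) addrC rpredB.
  have := pos_functional_hermitian gp b_h.
  rewrite /b (scalar_funZ g_lin) (scalar_funB g_lin).
  move/complex_realP: gsr => [s ->] /complex_realP[t] /eqP.
  rewrite eq_complex /= !(mul0r, mulr0, mul1r, subr0, add0r, addr0).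
  by move=> /andP[_ /eqP->]; rewrite mulr0.
have vs : star v = v.
  have b0 : b = 0.
    apply: Vpos_antisym; [apply: (hermP)|apply: (hermP)] => // [g gp||g gp].
    - by rewrite gb.
    - by rewrite starN b_h.
    - by rewrite (scalar_funN gp.1) gb// oppr0.
  apply/eqP; rewrite -subr_eq0; move/eqP: b0; rewrite scaler_eq0 => /orP[|//].
  by rewrite eq_complex /= oner_eq0 andbF.
exact: hermP.
Qed.

End AOU.

(** * Continuity of positive functionals for admissible norms *)

Lemma normcR (R : rcfType) (r : R) : ComplexField.Normc.normc r%:C%C = `|r|.
Proof. by rewrite /ComplexField.Normc.normc /= expr0n addr0 sqrtr_sqr. Qed.

Section NormTheory.
Variables (R : realType) (V : lmodType R[i]) (N : V -> R).
Hypothesis N_norm : is_norm N.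

Lemma is_normN v : N (- v) = N v.
Proof.
by rewrite -scaleN1r (norm_scale N_norm) normcN ComplexField.Normc.normc1 mul1r.
Qed.

End NormTheory.

Section ContinuousDual.
Variables (R : realType) (V : lmodType R[i]).
Variables (star : V -> V) (Vpos : set V) (e : V).
Hypothesis hV : is_AOU star Vpos e.

Let normc := @ComplexField.Normc.normc R.

Lemma cdualD f g : cdual star Vpos e f -> cdual star Vpos e g ->
  cdual star Vpos e (fun v => f v + g v).
Proof.
move=> [f_lin f_cont] [g_lin g_cont]; split.
  by move=> c u v; rewrite f_lin g_lin; ring.
move=> N N_adm u eps eps0; have eps20 : 0 < eps / 2 by rewrite divr_gt0.
have [d1 d10 fd] := f_cont N N_adm u _ eps20.
have [d2 d20 gd] := g_cont N N_adm u _ eps20.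
exists (Num.min d1 d2); first by rewrite lt_min d10.
move=> u'; rewrite lt_min => /andP[/fd fu /gd gu].
rewrite opprD addrACA [eps]splitr.
apply: le_lt_trans (le_normcD _ _) _.
exact: ltrD.
Qed.

Lemma cdualZ c f : cdual star Vpos e f -> cdual star Vpos e (fun v => c * f v).
Proof.
move=> [f_lin f_cont]; split; first by move=> a u v; rewrite f_lin; ring.
move=> N N_adm u eps eps0.
(* The summand 1 keeps the divisor positive when [c = 0]. *)
have c1_gt0 : 0 < normc c + 1.
  by rewrite ltr_wpDl//; case: c => a b; exact: sqrtr_ge0.
have [d d0 fd] := f_cont N N_adm u _ (divr_gt0 eps0 c1_gt0).
exists d => // u' /fd; rewrite ltr_pdivlMr// => fu.
rewrite -mulrBr ComplexField.Normc.normcM; apply: le_lt_trans fu.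
rewrite mulrC ler_wpM2l ?lerDl//.
by case: (f u' - f u) => a b; exact: sqrtr_ge0.
Qed.

(** Some [t <= eps] satisfies [- t e <= v <= t e]; applying [g] bounds the modulus of [g v] by [t]
    times the real number [g e]. *)
Lemma pos_functional_order_norm g v eps : pos_functional Vpos g ->
  star v = v -> order_norm Vpos e v < eps ->
  normc (g v) <= eps * complex.Re (g e).
Proof.
move=> gp v_h v_eps; have [g_lin g_pos] := gp.
have ge0 := g_pos _ (Vpos_unit hV).
have [t [t1 t2] t_eps] :
    exists2 t : R, Vpos (v + t%:C%C *: e) /\ Vpos (t%:C%C *: e - v) & t <= eps.
  (* When [e = 0] every real [t] qualifies, so [eps] itself serves. *)
  have [e0|e_neq0] := pselect (e = 0).
    exists eps => //; have [r _] := unit_order hV v_h.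
    have vN_h : star (- v) = - v by rewrite (starN hV) v_h.
    have [s _] := unit_order hV vN_h.
    by rewrite e0 !scaler0 addr0 !sub0r opprK.
  have [t tP /ltW ?] : exists2 t, [set t : R | Vpos (v + t%:C%C *: e) /\
      Vpos (t%:C%C *: e - v)] t & t < eps.
    apply: inf_lt v_eps.
    have vN_h : star (- v) = - v by rewrite (starN hV) v_h.
    have [r r0 rp] := unit_order hV v_h; have [s s0 sp] := unit_order hV vN_h.
    exists (r + s); split; rewrite /= rmorphD scalerDl.
      rewrite opprK addrC in sp; rewrite addrCA; apply: (pos_add hV) => //.
      by apply: (pos_scale hV); [exact: ltW|exact: (Vpos_unit hV)].
    rewrite addrAC; apply: (pos_add hV) => //.
    by apply: (pos_scale hV); [exact: ltW|exact: (Vpos_unit hV)].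
  by exists t.
have /complex_realP[s gs] := pos_functional_hermitian hV gp v_h.
have /complex_realP[k gk] := ger0_real ge0.
have := g_pos _ t1; have := g_pos _ t2.
rewrite (scalar_funB g_lin) (scalar_funD g_lin) !(scalar_funZ g_lin).
rewrite gs gk -rmorphM -rmorphB -rmorphD !ler0c => h1 h2.
rewrite gk ler0c in ge0.
rewrite /normc normcR; apply: (@le_trans _ _ (t * k)).
  by rewrite ler_norml; apply/andP; split; lra.
exact: ler_wpM2r.
Qed.

(** The order norm controls only Hermitian elements, so the increment [w] is written [(a + i b) / 2]
    with [a], [b] Hermitian; continuity of [star] at 0 makes both small. *)
Lemma pos_functional_cdual g : pos_functional Vpos g -> cdual star Vpos e g.
Proof.
move=> gp; have [g_lin g_pos] := gp; split => // N [N_norm N_order N_star] u eps eps0.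
have ge0 := g_pos _ (Vpos_unit hV).
have k0 : 0 <= complex.Re (g e) by move: ge0; rewrite lecE => /andP[].
set k := complex.Re (g e) in k0.
(* [N a] and [N b] will be below [2 eta], so [g w] has modulus at most [2 eta k], less than
   [4 eta (k + 1) = eps]; the 1 covers [k = 0]. *)
pose eta := eps / (4 * (k + 1)).
have eta0 : 0 < eta by rewrite divr_gt0// mulr_gt0// ltr_wpDl.
have [d d0 star_d] := N_star 0 eta eta0.
exists (Num.min d eta); first by rewrite lt_min d0.
move=> u'; rewrite lt_min -(scalar_funB g_lin); set w := u' - u.
move=> /andP[wd w_eta].
have sw_eta : N (star w) < eta.
  by have := star_d w; rewrite subr0 (star0 hV) subr0; exact.
pose a := w + star w; pose b := 'i%C *: (star w - w).
have a_h : star a = a := hermitian_part_star hV w.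
have b_h : star b = b := skew_part_star hV w.
have N_a : N a < eta + eta.
  exact: le_lt_trans (norm_triangle N_norm _ _) (ltrD _ _).
have N_b : N b < eta + eta.
  rewrite (norm_scale N_norm) /ComplexField.Normc.normc expr0n add0r expr1n.
  rewrite sqrtr1 mul1r; apply: le_lt_trans (norm_triangle N_norm _ _) _.
  by rewrite (is_normN N_norm) ltrD.
have wE : w = (2^-1 : R)%:C%C *: (a + 'i%C *: b).
  have -> : a + 'i%C *: b = w + w.
    by rewrite /b scalerA -expr2 sqr_i scaleN1r opprB /a addrACA subrr addr0.
  by rewrite -mulr2n -scaler_nat scalerA
    -(rmorph_nat (real_complex R)) -rmorphM mulVf ?pnatr_eq0// rmorph1 scale1r.
rewrite (N_order _ a_h) in N_a; have ga := pos_functional_order_norm gp a_h N_a.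
rewrite (N_order _ b_h) in N_b; have gb := pos_functional_order_norm gp b_h N_b.
rewrite wE (scalar_funZ g_lin) (scalar_funD g_lin) (scalar_funZ g_lin).
rewrite ComplexField.Normc.normcM normcR ger0_norm ?invr_ge0//.
apply: (@le_lt_trans _ _ (2^-1 * (normc (g a) + normc (g b)))).
  rewrite ler_pM2l ?invr_gt0//; apply: le_trans (le_normcD _ _) _.
  rewrite lerD2l ComplexField.Normc.normcM.
  by rewrite {1}/ComplexField.Normc.normc expr0n add0r expr1n sqrtr1 mul1r.
apply: (@le_lt_trans _ _ (2 * eta * k)).
  by move: ga gb; rewrite -/k; lra.
have -> : eps = eta * (4 * (k + 1)) by rewrite divfK// gt_eqF// mulr_gt0// ltr_wpDl.
nra.
Qed.

End ContinuousDual.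

(** * Positive semidefinite matrices *)

Section PsdTheory.
Variable R : realType.

Lemma qformE n (a : 'M[R[i]]_n) (x : 'cV[R[i]]_n) :
  (x ^t* *m a *m x) 0 0 = \sum_i \sum_j (x i 0)^* * x j 0 * a i j.
Proof.
rewrite mxE exchange_big; apply: eq_bigr => j _; rewrite mxE mulr_suml.
by apply: eq_bigr => i _; rewrite !mxE mulrAC.
Qed.

(** The first two terms in the bracket give [2 a_ij + (1 - i) (a_ii + a_jj)], and the last two
    cancel the diagonal entries. *)
Lemma qform_polarization n (a : 'M[R[i]]_n) i j :
  let q x := (x ^t* *m a *m x) 0 0 in
  let d k : 'cV[R[i]]_n := delta_mx k 0 in
  a i j = 2^-1 * (q (d i + d j) + (- 'i) * q (d i + 'i *: d j)
                  + ('i - 1) * q (d i) + ('i - 1) * q (d j)).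
Proof.
move=> q d; pose B (x y : 'cV[R[i]]_n) := (x ^t* *m a *m y) 0 0.
have BDl x y z : B (x + y) z = B x z + B y z.
  rewrite /B; have -> : (x + y) ^t* = x ^t* + y ^t*.
    by apply/matrixP=> k l; rewrite !mxE rmorphD.
  by rewrite 2!mulmxDl mxE.
have BDr x y z : B x (y + z) = B x y + B x z by rewrite /B mulmxDr mxE.
have BZl c x y : B (c *: x) y = c^* * B x y.
  rewrite /B; have -> : (c *: x) ^t* = c^* *: x ^t*.
    by apply/matrixP=> k l; rewrite !mxE rmorphM.
  by rewrite -2!scalemxAl mxE.
have BZr c x y : B x (c *: y) = c * B x y by rewrite /B -scalemxAr mxE.
have dE k l : B (d k) (d l) = a k l.
  rewrite /B mxE (bigD1 l) //= big1 => [|m ml]; last first.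
    by rewrite [d l _ _]mxE (negbTE ml) mulr0.
  rewrite addr0 [d l _ _]mxE !eqxx mulr1.
  rewrite mxE (bigD1 k) //= big1 => [|m mk]; last first.
    by rewrite !mxE (negbTE mk) conjC0 mul0r.
  by rewrite addr0 !mxE !eqxx conjC1 mul1r.
rewrite (_ : q = fun x => B x x)//; move: {q} B BDl BDr BZl BZr dE.
move=> B BDl BDr BZl BZr dE; rewrite !(BDl, BDr, BZl, BZr) !dE conjCi.
have i2 : 'i * 'i = -1 :> R[i] by rewrite -expr2 sqrCi.
apply: (mulfI (_ : 2 != 0)); rewrite ?pnatr_eq0// mulrA mulfV ?pnatr_eq0// mul1r.
ring: i2.
Qed.

(** The forms of [a] and its adjoint are complex conjugates, hence equal, being real; polarization
    recovers the entries. *)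
Lemma psd_hermitian n (a : 'M[R[i]]_n) : psd a -> a ^t* = a.
Proof.
move=> pa.
have q_star (x : 'cV[R[i]]_n) : (x ^t* *m a ^t* *m x) 0 0 = (x ^t* *m a *m x) 0 0.
  rewrite -[RHS](CrealP (ger0_real (pa x))).
  transitivity (((x ^t* *m a *m x) ^t*) 0 0); last by rewrite !mxE.
  by rewrite !trmx_mul !map_mxM trmxCK mulmxA.
apply/matrixP => i j.
by rewrite (qform_polarization (a ^t*)) (qform_polarization a) !q_star.
Qed.

Lemma psd1 n : psd (1%:M : 'M[R[i]]_n).
Proof.
move=> x; rewrite mulmx1 mxE sumr_ge0// => k _.
by rewrite !mxE mulrC mul_conjC_ge0.
Qed.

Lemma psd_rank1 n (x : 'cV[R[i]]_n) : psd (map_mx Num.conj x *m x^T).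
Proof.
move=> y; rewrite mulmxA -mulmxA mxE big_ord1 /=.
have -> : (y ^t* *m map_mx Num.conj x) 0 0 = ((x^T *m y) 0 0)^*.
  rewrite !mxE rmorph_sum; apply: eq_bigr => k _.
  by rewrite !mxE rmorphM mulrC.
by rewrite mulrC mul_conjC_ge0.
Qed.

(** Diagonalizing [a] turns the sum into eigenvalues of [a] times values of the quadratic form of
    [b] at the transposed rows of [P]. *)
Lemma psd_pairing_ge0 n (a b : 'M[R[i]]_n) : psd a -> psd b ->
  0 <= \sum_i \sum_j a i j * b i j.
Proof.
move=> pa pb.
have /hermitian_normalmx/orthomx_spectralP aE : a \is hermsymmx.
  by apply/is_hermitianmxP; rewrite expr0 scale1r psd_hermitian.
set P := spectralmx a in aE; set D := spectral_diag a in aE.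
have P_unitary : P \is unitarymx := spectral_unitarymx a.
rewrite invmx_unitary// in aE.
(* The form of [a] at the eigenvector [P ^t* *m d] is the eigenvalue. *)
have D_ge0 k : 0 <= D 0 k.
  pose d : 'cV[R[i]]_n := delta_mx k 0.
  have := pa (P ^t* *m d).
  have -> : (P ^t* *m d) ^t* *m a *m (P ^t* *m d) = d ^t* *m diag_mx D *m d.
    rewrite trmx_mul map_mxM trmxCK {1}aE !mulmxA.
    by rewrite !mulmxtVK.
  rewrite qformE (bigD1 k) //= (bigD1 k) //= !mxE !eqxx conjC1 !mul1r mulr1n.
  rewrite !big1 ?addr0// => [l lk|l lk].
    by rewrite big1// => m _; rewrite !mxE (negbTE lk) conjC0 !mul0r.
  by rewrite !mxE (negbTE lk) mulr0 mul0r.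
have aijE i j : a i j = \sum_k D 0 k * ((P k i)^* * P k j).
  rewrite {1}aE mxE; apply: eq_bigr => k _.
  by rewrite mul_mx_diag !mxE; ring.
have -> : \sum_i \sum_j a i j * b i j =
    \sum_k D 0 k * (((row k P)^T ^t* *m b *m (row k P)^T) 0 0).
  under [RHS]eq_bigr do rewrite qformE mulr_sumr.
  rewrite [RHS]exchange_big; apply: eq_bigr => i _.
  under [RHS]eq_bigr do rewrite mulr_sumr.
  rewrite [RHS]exchange_big; apply: eq_bigr => j _.
  rewrite aijE mulr_suml; apply: eq_bigr => k _.
  by rewrite !mxE; ring.
by apply: sumr_ge0 => k _; rewrite mulr_ge0.
Qed.

End PsdTheory.

(** * Pairing matrices of functionals with matrices over [V] *)

Section MatrixPairing.
Variables (R : realType) (V : lmodType R[i]) (n : nat).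

Lemma mx_entries_scalar (f : 'M[V]_n -> R[i]) i j :
  mx_linear f -> scalar (mx_entries n f i j).
Proof.
move=> f_lin c u v; rewrite mxE -f_lin; congr f.
by apply/matrixP => k l; rewrite !mxE scalerDr !scalerA mulrC.
Qed.

Variable F : 'M[V -> R[i]]_n.
Hypothesis F_lin : forall i j, scalar (F i j).

Lemma mx_pairing_linear : mx_linear (mx_pairing F).
Proof.
move=> c A B; rewrite /mx_pairing mulr_sumr -big_split; apply: eq_bigr => i _.
rewrite mulr_sumr -big_split; apply: eq_bigr => j _.
by rewrite !mxE F_lin.
Qed.

Lemma mx_pairing_tensor a v :
  mx_pairing F (mxtensor a v) = \sum_i \sum_j a i j * F i j v.
Proof.
apply: eq_bigr => i _; apply: eq_bigr => j _.
by rewrite mxE (scalar_funZ (F_lin i j)).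
Qed.

(** This links the two notions of positivity: semidefiniteness of the matrix of values at [v] is
    nonnegativity of the pairing on rank-one tensors. *)
Lemma qform_mx_pairing (x : 'cV[R[i]]_n) v :
  (x ^t* *m map_mx (fun f : V -> R[i] => f v) F *m x) 0 0 =
  mx_pairing F (mxtensor (map_mx Num.conj x *m x^T) v).
Proof.
rewrite qformE mx_pairing_tensor; apply: eq_bigr => i _; apply: eq_bigr => j _.
by rewrite !mxE big_ord1 !mxE.
Qed.

End MatrixPairing.

Lemma mx_pairing_congr_diag (R : realType) (V : lmodType R[i]) m n
    (X : 'M[R[i]]_(m, n)) (g : 'I_m -> V -> R[i]^o) (A : 'M[V]_n) :
  (forall k, scalar (g k : V -> R[i])) ->
  mx_pairing (congr_mx X (diag_mx (\row_k g k))) A =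
  \sum_k g k (\sum_i \sum_j ((X k i)^* * X k j) *: A i j).
Proof.
move=> g_lin.
have entryE i j v : congr_mx X (diag_mx (\row_k g k)) i j v =
    \sum_k (X k i)^* * X k j * g k v.
  rewrite mxE fct_sumE; apply: eq_bigr => k _; rewrite mxE.
  rewrite (bigD1 k) //= big1 => [|l lk]; last first.
    by rewrite !mxE (negbTE lk) mulr0n scaler0.
  rewrite addr0 !mxE eqxx mulr1n.
  by rewrite -mulrA mulrCA.
rewrite /mx_pairing.
under [RHS]eq_bigr => k _.
  rewrite (scalar_fun_sum (g_lin k)).
  under eq_bigr do rewrite (scalar_fun_sum (g_lin k)).
  over.
rewrite [RHS]exchange_big; apply: eq_bigr => i _.
rewrite [RHS]exchange_big; apply: eq_bigr => j _.
rewrite entryE; apply: eq_bigr => k _.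
by rewrite (scalar_funZ (g_lin k)).
Qed.

(** * The two duality identities *)

Section Duality.
Variables (R : realType) (V : lmodType R[i]).
Variables (star : V -> V) (Vpos : set V) (e : V).
Hypothesis hV : is_AOU star Vpos e.
Variable n : nat.

Lemma mxtensor1 (v : V) : mxtensor (1%:M : 'M[R[i]]_n) v = v%:M.
Proof. by apply/matrixP => i j; rewrite !mxE -scalerMnl scale1r. Qed.

(** The perturbation [r e_n] is itself the elementary tensor of the identity matrix with [r e]. *)
Lemma Cmax_tensor (a : 'M[R[i]]_n) v :
  psd a -> Vpos v -> Cmax Vpos e n (mxtensor a v).
Proof.
move=> pa vp r r0.
exists 2, (fun l : 'I_2 => if l == 0 then 1%:M else a),
  (fun l : 'I_2 => if l == 0 then r%:C%C *: e else v); split.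
- by move=> l; case: (l == 0); [exact: psd1|].
- move=> l; case: ifP => _ //.
  by apply: (pos_scale hV); [exact: ltW|exact: (Vpos_unit hV)].
- rewrite big_ord_recl big_ord1 /=; congr (_ + _).
  by rewrite mxtensor1; apply/matrixP => i j; rewrite !mxE scalerMnr.
Qed.

Lemma predual_Qmin : mx_predual (Qmin Vpos n) = Cmin Vpos n.
Proof.
apply/seteqP; split => [A QA lam|A CA F [m [X [g [gp ->]]]]].
  apply: (Vpos_from_pos_functional hV) => g gp.
  (* The case [m = 1], with [X] the row [lam]. *)
  have := QA (congr_mx (\row_j lam j) (diag_mx (\row_(k < 1) (g : V -> R[i]^o)))).
  rewrite mx_pairing_congr_diag => [|_]; last exact: gp.1.
  rewrite big_ord1.
  under eq_bigr do under eq_bigr do rewrite !mxE.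
  by apply; exists 1%N, (\row_j lam j), (fun=> g).
rewrite mx_pairing_congr_diag => [|k]; last exact: (gp k).1.
by apply: sumr_ge0 => k _; apply: (gp k).2; exact: CA.
Qed.

(** Polarization writes the entry as a combination of four functionals [q x]; each evaluates [f] on
    rank-one tensors, so it is positive and therefore continuous. *)
Lemma mx_entries_cdual (f : 'M[V]_n -> R[i]) i j :
  mx_dual (Cmax Vpos e n) f -> cdual star Vpos e (mx_entries n f i j).
Proof.
move=> [f_lin f_pos].
pose F := mx_entries n f.
have F_lin k l : scalar (F k l) := mx_entries_scalar k l f_lin.
pose q (x : 'cV[R[i]]_n) v := (x ^t* *m map_mx (fun f : V -> R[i] => f v) F *m x) 0 0.
have q_cdual x : cdual star Vpos e (q x).
  apply: (pos_functional_cdual hV); split=> [c u v|v vp]; rewrite /q.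
    rewrite !qform_mx_pairing// (mx_entriesK f_lin) -f_lin; congr f.
    by apply/matrixP => k l; rewrite !mxE scalerDr !scalerA mulrC.
  rewrite qform_mx_pairing// (mx_entriesK f_lin); apply: f_pos.
  exact: (Cmax_tensor (psd_rank1 x)).
have -> : F i j = (fun v => 2^-1 * (q (delta_mx i 0 + delta_mx j 0) v
    + (- 'i) * q (delta_mx i 0 + 'i *: delta_mx j 0) v
    + ('i - 1) * q (delta_mx i 0) v + ('i - 1) * q (delta_mx j 0) v)).
  apply/funext => v.
  by have := qform_polarization (map_mx (fun f : V -> R[i] => f v) F) i j; rewrite mxE.
by apply: cdualZ; do !apply: cdualD => //; apply: cdualZ.
Qed.

Lemma dual_Cmax : mx_entries n @` mx_dual (Cmax Vpos e n) = Qmax star Vpos e n.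
Proof.
apply/seteqP; split => [_ [f f_dual <-]|F [F_cdual F_psd]].
  split=> [i j|v vp x]; first exact: mx_entries_cdual.
  have [f_lin f_pos] := f_dual.
  rewrite qform_mx_pairing => [|i j]; last exact: mx_entries_scalar.
  by rewrite (mx_entriesK f_lin); apply/f_pos/Cmax_tensor => //; exact: psd_rank1.
have F_lin i j : scalar (F i j) := (F_cdual i j).1.
exists (mx_pairing F); last exact: mx_pairingK.
split; first exact: mx_pairing_linear.
have tensor_ge0 (a : 'M[R[i]]_n) v : psd a -> Vpos v ->
    0 <= mx_pairing F (mxtensor a v).
  move=> pa vp; rewrite mx_pairing_tensor//.
  have := psd_pairing_ge0 pa (F_psd v vp).
  by under eq_bigr do under eq_bigr do rewrite [map_mx _ _ _ _]mxE.
have pairingD A B : mx_pairing F (A + B) = mx_pairing F A + mx_pairing F B.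
  have := mx_pairing_linear F_lin 1 A B; rewrite mul1r => <-.
  by congr mx_pairing; apply/matrixP => i j; rewrite !mxE scale1r.
have Dmax_ge0 A : Dmax Vpos n A -> 0 <= mx_pairing F A.
  move=> [k [a [v [pa vp ->]]]].
  have pairing0 : mx_pairing F 0 = 0.
    by rewrite /mx_pairing big1 // => i _; rewrite big1// => j _; rewrite mxE scalar_fun0.
  rewrite (big_morph _ pairingD pairing0).
  by apply: sumr_ge0 => l _; exact: tensor_ge0.
move=> A CA.
(* Only the perturbed values [r k + F(A)] are known to be nonnegative, [k] being the value at [e_n];
   [r = 1] shows that [F(A)] is real, and small [r] gives its sign. *)
have /complex_realP[k kE] : mx_pairing F e%:M \is Num.real.
  by rewrite -mxtensor1 ger0_real// tensor_ge0//; [exact: psd1|exact: (Vpos_unit hV)].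
have rkA r : 0 < r -> 0 <= (r * k)%:C%C + mx_pairing F A.
  by move=> r0; rewrite rmorphM /= -kE -(mx_pairing_linear F_lin); exact/Dmax_ge0/CA.
case: (mx_pairing F A) rkA => s t rkA.
have t0 : t = 0.
  by have := rkA 1 ltr01; rewrite lecE /= add0r => /andP[/eqP].
rewrite t0 lecR.
(* For [k <= 0] the value at [r = 1] suffices; otherwise [r = eps / k] makes the perturbation
   exactly [eps]. *)
have [k0|k0] := leP k 0.
  have := rkA 1 ltr01; rewrite lecE /= => /andP[_].
  by move=> H; apply: le_trans H _; rewrite mul1r gerDr.
apply/ler_addgt0Pr => eps eps0.
have := rkA (eps / k) (divr_gt0 eps0 k0); rewrite lecE /= => /andP[_].
by rewrite divfK ?gt_eqF// addrC.
Qed.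

End Duality.

Theorem theorem4p8 (R : realType) (V : lmodType R[i])
    (star : V -> V) (Vpos : set V) (e : V)
    (hV : is_AOU star Vpos e) (n : nat) :
  mx_predual (Qmin Vpos n) = Cmin Vpos n /\
  mx_entries n @` mx_dual (Cmax Vpos e n) = Qmax star Vpos e n.
Proof. by split; [exact: predual_Qmin hV n|exact: dual_Cmax]. Qed.
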